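(* Let $n\geq 3$ be an integer and let $p(z)=z^n+a_{n-1}z^{n-1}+a_{n-2}z^{n-2}+\ldots+a_1z+a_0$ be a monic polynomial with complex coefficients and $a_0\neq 0$. Set $a_{-1}=0$, $b_j=a_{n-1}a_j-a_{j-1}$ for $j=0,1,2,\ldots,n-1$, and $b_{-1}=0$. If $z\in\mathbb{C}$ is any zero of $p$, then \[\begin{aligned} |z|^2\leq{}& \cos^2 \frac{\pi}{n+1}+\frac{1}{4} \left( (1+|b_{n-1}|)^2+\sum_{j=0}^{n-2}|b_j|^2 \right)\\ &+ \frac{1}{4}\sqrt{|b_{n-2}|^2+(1+|b_{n-1}|+|b_{n-3}|)^2+ \sum_{j=0}^{n-3}(|b_{j+1}|+|b_{j-1}|)^2}. \end{aligned}\] *)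

(* Defs.v *)
From mathcomp Require Export all_boot all_order all_algebra.
From mathcomp Require Export complex.
From mathcomp Require Export reals trigo.
Export GRing.Theory Num.Theory.

Set Implicit Arguments.
Unset Strict Implicit.
Unset Printing Implicit Defensive.

(* The library norm `|z| on R[i] takes its values in R[i]; [normc] is the
   same modulus with values in R. *)
Notation normc := Normc.normc.

(* Main.v *)
(* Multiplying [p(z) = 0] by [z - a (n - 1)] gives [z ^ (n + 1) = \sum_j b j * z ^ j]
   without a term in [z ^ n].  Put [r = |z|].  Then the vector [y] with entries
   [r ^ n, ..., r, 1] satisfies [2 r |y|^2 <= <H y, y>], where [H] is the real
   symmetric matrix of order [n + 1] which is the sum of a star [H1] centred at the
   first coordinate, with weights [1 + |b (n - 1)|, |b (n - 2)|, ..., |b 0|], and of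
   the adjacency matrix [H2] of the path on the other [n] coordinates.  Hence
   [4 r^2 <= |H|^2 <= |H1^2| + |H2^2| + |H1 H2 + H2 H1|], and these three norms are
   the three terms of the bound; [|H2| = 2 cos (pi / (n + 1))] because the sines
   [sin (k pi / (n + 1))] form a positive eigenvector of [H2]. *)
Require Import Defs.
From mathcomp Require Import all_boot all_order all_algebra.
From mathcomp Require Import complex reals trigo.
From mathcomp Require Import zify ring lra.

Import Order.TTheory.

Local Open Scope ring_scope.
Local Open Scope complex_scope.

(** Lagrange's identity: twice the defect is the double sum of the squares
    [(x i * y j - x j * y i) ^+ 2]. *)
Lemma cauchy_schwarz_sum (R : realDomainType) (I : finType) (x y : I -> R) :
  (\sum_i x i * y i) ^+ 2 <= (\sum_i x i ^+ 2) * (\sum_i y i ^+ 2).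
Proof.
have lagrange : \sum_i \sum_j (x i * y j - x j * y i) ^+ 2 =
    2 * ((\sum_i x i ^+ 2) * (\sum_i y i ^+ 2) - (\sum_i x i * y i) ^+ 2).
  rewrite mulrBr mulr_natl mulr2n [X in _ = X + _ - _]mulrC expr2 !big_distrlr /=.
  rewrite -big_split mulr_sumr -sumrB /=.
  apply: eq_bigr => i _; rewrite -big_split mulr_sumr -sumrB /=.
  by apply: eq_bigr => j _; ring.
rewrite -subr_ge0 -(@pmulr_rge0 _ 2) // -lagrange.
by apply: sumr_ge0 => i _; apply: sumr_ge0 => j _; apply: sqr_ge0.
Qed.

(** Symmetry of the adjacency matrix of the path; zeros at [0] and [n.+1] spare the end vertices a
    separate case. *)
Lemma sum_neighbours (R : pzRingType) (n : nat) (x y : nat -> R) :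
  x 0%N = 0 -> x n.+1 = 0 -> y 0%N = 0 -> y n.+1 = 0 ->
  \sum_(i < n) x i.+1 * (y i + y i.+2) = \sum_(i < n) (x i + x i.+2) * y i.+1.
Proof.
have shift (F : nat -> R) : F 0%N = 0 -> F n = 0 ->
    \sum_(i < n) F i = \sum_(i < n) F i.+1.
  move=> F0 Fn; have := big_ord_recl n (fun i : 'I_n.+1 => F i) => /(_ 0 +%R).
  by rewrite big_ord_recr /= F0 Fn add0r addr0 => ->; apply: eq_bigr.
move=> x0 xn y0 yn.
under eq_bigr do rewrite mulrDr.
under [RHS]eq_bigr do rewrite mulrDl.
rewrite !big_split /= [RHS]addrC; congr (_ + _).
  by rewrite (shift (fun i => x i.+1 * y i)) ?y0 ?xn ?mulr0 ?mul0r.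
by rewrite (shift (fun i => x i * y i.+1)) ?x0 ?yn ?mulr0 ?mul0r.
Qed.

(** Weighted Cauchy-Schwarz. A weight may vanish together with its term, as [0 / 0 = 0]; this
    happens at the padded ends of the path. *)
Lemma sqr_add_le_weighted (R : realFieldType) (x y s t : R) :
  (0 < s) || (x == 0) && (s == 0) -> (0 < t) || (y == 0) && (t == 0) ->
  (x + y) ^+ 2 <= (s + t) * (x ^+ 2 / s + y ^+ 2 / t).
Proof.
case/orP=> [s0|/andP[/eqP-> /eqP->]]; case/orP=> [t0|/andP[/eqP-> /eqP->]].
- have -> : (s + t) * (x ^+ 2 / s + y ^+ 2 / t) =
      (x + y) ^+ 2 + (x * t - y * s) ^+ 2 / (s * t).
    by field; rewrite !gt_eqF.
  by rewrite lerDl divr_ge0 ?sqr_ge0 ?mulr_ge0 ?ltW.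
- by rewrite expr0n /= mul0r !addr0 mulrC divfK ?gt_eqF.
- by rewrite expr0n /= mul0r !add0r mulrC divfK ?gt_eqF.
- by rewrite !addr0 mul0r expr0n.
Qed.

(* Schur test: [s] is a positive eigenvector, for the eigenvalue [2 * c], of the
   adjacency matrix of the path on [n] vertices. *)
Lemma path_norm_le (R : realFieldType) (n : nat) (c : R) (s u : nat -> R) :
  s 0%N = 0 -> s n.+1 = 0 -> (forall i, (i < n)%N -> 0 < s i.+1) ->
  (forall i, s i + s i.+2 = 2 * c * s i.+1) ->
  u 0%N = 0 -> u n.+1 = 0 ->
  \sum_(i < n) (u i + u i.+2) ^+ 2 <= 4 * c ^+ 2 * \sum_(i < n) u i.+1 ^+ 2.
Proof.
move=> s0 sn s_gt0 s_eig u0 un; pose g k := u k ^+ 2 / s k.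
have weight k : (k <= n.+1)%N -> (0 < s k) || (u k == 0) && (s k == 0).
  case: k => [_|k]; first by rewrite u0 s0 eqxx orbT.
  rewrite ltnS leq_eqVlt => /orP[/eqP->|/s_gt0->//].
  by rewrite un sn eqxx orbT.
apply: (@le_trans _ _ (\sum_(i < n) 2 * c * (s i.+1 * (g i + g i.+2)))).
  apply: ler_sum => i _; rewrite mulrA -s_eig.
  by apply: sqr_add_le_weighted; apply: weight; have := ltn_ord i; lia.
(* Symmetry moves the neighbours from [g] to [s]; the eigenvector equation then gives a second
   [2 * c], and [s i.+1 * g i.+1] is [u i.+1 ^+ 2]. *)
rewrite -mulr_sumr sum_neighbours // ?/g ?u0 ?un ?expr0n ?mul0r //.
rewrite !mulr_sumr; apply: ler_sum => i _; rewrite s_eig le_eqVlt.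
by apply/orP; left; apply/eqP; field; rewrite gt_eqF // s_gt0.
Qed.

Lemma path_norm_le_cos (R : realType) (n : nat) (u : nat -> R) :
  u 0%N = 0 -> u n.+1 = 0 ->
  \sum_(i < n) (u i + u i.+2) ^+ 2 <=
    4 * cos (pi / n.+1%:R) ^+ 2 * \sum_(i < n) u i.+1 ^+ 2.
Proof.
set th := pi / _; have n1_gt0 : 0 < n.+1%:R :> R by rewrite ltr0n.
have thE : n.+1%:R * th = pi by rewrite mulrC divfK ?gt_eqF.
have th_gt0 : 0 < th by rewrite divr_gt0 ?pi_gt0.
apply: (@path_norm_le _ _ _ (fun k => sin (k%:R * th))).
- by rewrite mul0r sin0.
- by rewrite thE sinpi.
- move=> i ltin; apply: sin_gt0_pi; rewrite mulr_gt0 ?ltr0n //= -thE.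
  by rewrite ltr_pM2r // ltr_nat ltnS.
- move=> i; have -> : i%:R * th = i.+1%:R * th - th.
    by rewrite -[i.+1]addn1 natrD; ring.
  have -> : i.+2%:R * th = i.+1%:R * th + th.
    by rewrite -[i.+2]addn1 natrD; ring.
  by rewrite sinB sinD; ring.
Qed.

(* For [y = (t, u)] the hypothesis reads [2 r |y|^2 <= <H y, y>]; the proof uses
   [<H y, y>^2 <= |H y|^2 |y|^2], where [A] and [B i] are the entries of [H y]. *)
Lemma star_path_bound (R : realType) (n : nat) (r t : R) (u v : nat -> R) :
  0 <= r -> t != 0 ->
  u 0%N = 0 -> u n.+1 = 0 -> v 0%N = 0 -> v n.+1 = 0 ->
  2 * r * (t ^+ 2 + \sum_(i < n) u i.+1 ^+ 2) <=
    t * \sum_(i < n) v i.+1 * u i.+1 +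
    \sum_(i < n) (t * v i.+1 + (u i + u i.+2)) * u i.+1 ->
  4 * r ^+ 2 <= 4 * cos (pi / n.+1%:R) ^+ 2 + \sum_(i < n) v i.+1 ^+ 2
    + Num.sqrt (\sum_(i < n) (v i + v i.+2) ^+ 2).
Proof.
move=> r0 t0 u0 un v0 vn.
set U := \sum_(i < n) u i.+1 ^+ 2; set A := \sum_(i < n) v i.+1 * u i.+1.
set V := \sum_(i < n) v i.+1 ^+ 2; set W := \sum_(i < n) (v i + v i.+2) ^+ 2.
pose B i := t * v i.+1 + (u i + u i.+2) => hyp.
have U0 : 0 <= U by apply: sumr_ge0 => i _; apply: sqr_ge0.
have W0 : 0 <= W by apply: sumr_ge0 => i _; apply: sqr_ge0.
have N0 : 0 < t ^+ 2 + U by rewrite ltr_pwDl // exprn_even_gt0.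
(* Cauchy-Schwarz on [n + 1] coordinates; [ord0], where [unlift] returns [None], is the centre of
   the star. *)
have cs : (t * A + \sum_(i < n) B i * u i.+1) ^+ 2 <=
    (A ^+ 2 + \sum_(i < n) B i ^+ 2) * (t ^+ 2 + U).
  have := @cauchy_schwarz_sum R 'I_n.+1
    (fun i => oapp (fun j : 'I_n => B j) A (unlift ord0 i))
    (fun i => oapp (fun j : 'I_n => u j.+1) t (unlift ord0 i)).
  rewrite !big_ord_recl unlift_none /= [A * t]mulrC.
  under eq_bigr do rewrite liftK /=.
  under [X in _ <= (_ + X) * _]eq_bigr do rewrite liftK /=.
  by under [X in _ <= _ * (_ + X)]eq_bigr do rewrite liftK /=.
have BE : \sum_(i < n) B i ^+ 2 = t ^+ 2 * V
    + 2 * t * \sum_(i < n) (v i + v i.+2) * u i.+1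
    + \sum_(i < n) (u i + u i.+2) ^+ 2.
  rewrite -sum_neighbours // !mulr_sumr -!big_split /=.
  by apply: eq_bigr => i _; rewrite /B; ring.
have A_le : A ^+ 2 <= V * U by apply: cauchy_schwarz_sum.
have := path_norm_le_cos _ _ _ u0 un; rewrite -/U => path_le.
(* The form of [H1 H2 + H2 H1]: Cauchy-Schwarz, then [4 t^2 U <= (t^2 + U)^2]. *)
have cross_le : 2 * t * \sum_(i < n) (v i + v i.+2) * u i.+1 <=
    Num.sqrt W * (t ^+ 2 + U).
  have := @cauchy_schwarz_sum R 'I_n (fun i => v i + v i.+2) (fun i => u i.+1).
  rewrite -/U -/W; set S := \sum_(i < n) _ => S_le.
  apply: le_trans (ler_norm _) _.
  rewrite -ler_sqr ?nnegrE ?mulr_ge0 ?sqrtr_ge0 ?(ltW N0) //.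
  rewrite real_normK ?num_real // [leRHS]exprMn sqr_sqrtr //.
  apply: (@le_trans _ _ (4 * t ^+ 2 * (W * U))).
    rewrite (_ : (2 * t * S) ^+ 2 = 4 * t ^+ 2 * S ^+ 2); last by ring.
    by rewrite ler_wpM2l // mulr_ge0 ?sqr_ge0.
  rewrite -subr_ge0 (_ : _ - _ = W * (t ^+ 2 - U) ^+ 2); last by ring.
  by rewrite mulr_ge0 ?sqr_ge0.
have sq_le : (2 * r * (t ^+ 2 + U)) ^+ 2 <=
    (A ^+ 2 + \sum_(i < n) B i ^+ 2) * (t ^+ 2 + U).
  apply: le_trans cs; rewrite ler_sqr ?nnegrE // ?mulr_ge0 ?(ltW N0) //.
  by apply: le_trans hyp; rewrite !mulr_ge0 // ltW.
have norm_le : 4 * r ^+ 2 * (t ^+ 2 + U) <= A ^+ 2 + \sum_(i < n) B i ^+ 2.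
  rewrite -(ler_pM2r N0); apply: le_trans sq_le.
  by rewrite le_eqVlt; apply/orP; left; apply/eqP; ring.
rewrite -(ler_pM2r N0); apply: le_trans norm_le _; rewrite BE.
set c := cos _ in path_le *.
(* [path_le] yields only [4 c^2 U]; this term supplies the remaining [4 c^2 t^2]. *)
have ct_ge0 : 0 <= c ^+ 2 * t ^+ 2 by rewrite mulr_ge0 ?sqr_ge0.
by lra.
Qed.

Lemma normcX (R : rcfType) (x : R[i]) (k : nat) : normc (x ^+ k) = normc x ^+ k.
Proof.
elim: k => [|k IHk]; first exact: Normc.normc1.
by rewrite !exprS Normc.normcM IHk.
Qed.

Lemma normc_sum_le (R : rcfType) (I : finType) (F : I -> R[i]) :
  normc (\sum_i F i) <= \sum_i normc (F i).
Proof.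
elim/big_ind2: _ => [|x1 x2 y1 y2 le1 le2|//]; first by rewrite Normc.normc0.
by apply: le_trans (le_normcD _ _) _; apply: lerD.
Qed.

Lemma normc_ge0 (R : rcfType) (x : R[i]) : 0 <= normc x.
Proof. by case: x => x y; apply: sqrtr_ge0. Qed.

(* The relation [(z - a (n - 1)) * p(z) = 0]; its coefficient of [z ^ n] vanishes. *)
Lemma root_shifted (F : comNzRingType) (n : nat) (a b : int -> F) (z : F) :
  a (- 1) = 0 ->
  (forall j : nat, (j < n.+1)%N ->
     b j%:Z = a n%:Z * a j%:Z - a (j%:Z - 1)) ->
  root ('X^(n.+1) + \sum_(j < n.+1) a j%:Z *: 'X^j) z ->
  z ^+ n.+2 = \sum_(j < n.+1) b j%:Z * z ^+ j.
Proof.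
move=> a1 bE; rewrite rootE hornerD hornerXn horner_sum => /eqP.
under eq_bigr do rewrite hornerZ hornerXn.
move=> pz0; under eq_bigr => j _ do rewrite bE // mulrBl -mulrA.
rewrite sumrB -mulr_sumr.
have -> : \sum_(j < n.+1) a (j%:Z - 1) * z ^+ j = z * \sum_(j < n) a j%:Z * z ^+ j.
  rewrite big_ord_recl /= sub0r a1 mul0r add0r mulr_sumr; apply: eq_bigr => j _.
  by rewrite /bump /= (_ : (1 + j)%N%:Z - 1 = j%:Z) ?add1n ?exprS; [ring|lia].
move: pz0; rewrite big_ord_recr /=.
set S := \sum_(j < n) _ => /eqP; rewrite addr_eq0 => /eqP zE.
(* The equation is used twice, for [z * z ^+ n.+1] and then for [z * z ^+ n]. *)
rewrite exprS zE; rewrite exprS in zE.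
by ring: zE.
Qed.

Theorem corollary2p12 (R : realType) (n : nat) (p : {poly R[i]})
    (a b : int -> R[i]) (z : R[i]) :
  (3 <= n)%N ->
  p = 'X^n + \sum_(j < n) a j%:Z *: 'X^j ->
  a 0 != 0 ->
  a (- 1) = 0 ->
  (forall j : nat, (j < n)%N ->
     b j%:Z = a (n%:Z - 1) * a j%:Z - a (j%:Z - 1)) ->
  b (- 1) = 0 ->
  root p z ->
  normc z ^+ 2 <=
    cos (pi / (n.+1)%:R) ^+ 2
    + 1 / 4 * ((1 + normc (b (n%:Z - 1))) ^+ 2
               + \sum_(j < n.-1) normc (b j%:Z) ^+ 2)
    + 1 / 4 * Num.sqrt
        (normc (b (n%:Z - 2)) ^+ 2
         + (1 + normc (b (n%:Z - 1)) + normc (b (n%:Z - 3))) ^+ 2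
         + \sum_(j < n.-2)
             (normc (b (j%:Z + 1)) + normc (b (j%:Z - 1))) ^+ 2).
Proof.
case: n => [|[|[|m]]] // _ -> a0 a1 bE b1 pz0.
have n1E : m.+3%:Z - 1 = m.+2%:Z by lia.
have n2E : m.+3%:Z - 2 = m.+1%:Z by lia.
have n3E : m.+3%:Z - 3 = m%:Z by lia.
rewrite n1E in bE; rewrite n1E n2E n3E /=.
have zE := root_shifted _ _ _ _ _ a1 bE pz0.
(* Makes [t = r ^+ m.+3] nonzero below. *)
have z_neq0 : z != 0.
  apply: contraNneq a0 => z0; move: pz0.
  rewrite z0 rootE hornerD hornerXn expr0n add0r horner_sum big_ord_recl /=.
  rewrite hornerZ hornerXn mulr1 big1 ?addr0 // => j _.
  by rewrite hornerZ hornerXn expr0n mulr0.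
pose r := normc z; pose w k := normc (b k%:Z).
(* The shift [u i.+1 = r ^+ i] leaves [0] and [m.+4] for padding. The extra [1] in [v] is the edge
   from the centre [r ^+ m.+3] to [r ^+ m.+2]. *)
pose u k := if (0 < k <= m.+3)%N then r ^+ k.-1 else 0.
pose v k := if k == m.+3 then 1 + w m.+2
            else if (0 < k <= m.+3)%N then w k.-1 else 0.
have r_gt0 : 0 < r.
  rewrite lt_def normc_ge0 andbT; apply: contra z_neq0 => /eqP.
  by move=> /Normc.eq0_normc ->.
have r_le : r ^+ m.+4 <= \sum_(j < m.+3) w j * r ^+ j.
  rewrite -normcX zE; apply: le_trans (normc_sum_le _ _ _) _.
  by apply: ler_sum => j _; rewrite Normc.normcM normcX.
have uE (i : nat) : (i < m.+3)%N -> u i.+1 = r ^+ i by move=> lti; rewrite /u lti.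
have vE (i : nat) : (i < m.+2)%N -> v i.+1 = w i.
  by move=> lti; rewrite /v /= eqSS ltn_eqF // ltnS ltnW.
have vlast : v m.+3 = 1 + w m.+2 by rewrite /v eqxx.
have u0 : u 0%N = 0 by [].
have v0 : v 0%N = 0 by [].
have un : u m.+4 = 0 by rewrite /u ltnn andbF.
have vn : v m.+4 = 0 by rewrite /v ltnn andbF gtn_eqF.
(* Only [r_le], multiplied by [r ^+ m.+3], is an inequality; the edges match exactly, since
   [r^i * r^(i+1) = r * (r^i)^2]. *)
have hyp : 2 * r * ((r ^+ m.+3) ^+ 2 + \sum_(i < m.+3) u i.+1 ^+ 2) <=
    r ^+ m.+3 * (\sum_(i < m.+3) v i.+1 * u i.+1) +
    \sum_(i < m.+3) (r ^+ m.+3 * v i.+1 + (u i + u i.+2)) * u i.+1.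
  have AE : \sum_(i < m.+3) v i.+1 * u i.+1 =
      r ^+ m.+2 + \sum_(j < m.+3) w j * r ^+ j.
    rewrite big_ord_recr [in RHS]big_ord_recr /= vlast uE // mulrDl mul1r [RHS]addrCA; congr (_ + _).
    by apply: eq_bigr => i _; rewrite vE // uE // ltnS ltnW.
  have PE : \sum_(i < m.+3) (u i + u i.+2) * u i.+1 =
      2 * r * \sum_(i < m.+2) (r ^+ i) ^+ 2.
    under eq_bigr do rewrite mulrDl.
    rewrite big_split /= big_ord_recl u0 mul0r add0r.
    rewrite [X in _ + X]big_ord_recr /= un mul0r addr0.
    rewrite -big_split mulr_sumr /=; apply: eq_bigr => i _.
    have lti := ltn_ord i; rewrite /bump /= add1n !uE ?ltnS //; last by lia.
    by rewrite exprS; ring.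
  have BE : \sum_(i < m.+3) (r ^+ m.+3 * v i.+1 + (u i + u i.+2)) * u i.+1 =
      r ^+ m.+3 * (\sum_(i < m.+3) v i.+1 * u i.+1) +
      \sum_(i < m.+3) (u i + u i.+2) * u i.+1.
    rewrite mulr_sumr -big_split /=; apply: eq_bigr => i _.
    by rewrite mulrDl mulrA.
  have UE : \sum_(i < m.+3) u i.+1 ^+ 2 =
      \sum_(i < m.+2) (r ^+ i) ^+ 2 + (r ^+ m.+2) ^+ 2.
    by rewrite big_ord_recr /= uE //; congr (_ + _); apply: eq_bigr => i _;
      rewrite uE // ltnS ltnW.
  rewrite BE AE PE UE.
  have := ler_wpM2l (exprn_ge0 m.+3 (ltW r_gt0)) r_le.
  rewrite [r ^+ m.+4]exprS !(exprS r m.+2).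
  set S := \sum_(j < m.+3) _; set S2 := \sum_(i < m.+2) _; set q := r ^+ m.+2.
  by move=> ?; lra.
have := star_path_bound _ _ _ _ _ _ (ltW r_gt0) (expf_neq0 _ (lt0r_neq0 r_gt0)) u0 un v0 vn hyp.
have -> : \sum_(i < m.+3) v i.+1 ^+ 2 =
    (1 + w m.+2) ^+ 2 + \sum_(j < m.+2) w j ^+ 2.
  rewrite big_ord_recr /= vlast addrC; congr (_ + _).
  by apply: eq_bigr => i _; rewrite vE.
(* The indices [m.+2] and [m.+1] give the two separate squares: [v m.+4 = 0], and [v m.+3] carries
   the [1]. At index [0], [v 0 = 0] agrees with [b (- 1) = 0]. *)
have -> : \sum_(i < m.+3) (v i + v i.+2) ^+ 2 =
    w m.+1 ^+ 2 + (1 + w m.+2 + w m) ^+ 2 +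
    \sum_(j < m.+1) (normc (b (j%:Z + 1)) + normc (b (j%:Z - 1))) ^+ 2.
  rewrite 2!big_ord_recr /= vn addr0 vlast !vE // -addrA addrC.
  rewrite [X in X + _ = _]addrC [w m + _]addrC; congr (_ + _).
  apply: eq_bigr => i _; have lti := ltn_ord i.
  rewrite vE ?ltnS // addrC /w; congr ((normc (b _) + _) ^+ 2); first by lia.
  case: i lti => [[|k] ?] /= ltk; first by rewrite b1 Normc.normc0.
  by rewrite vE /w; [congr (normc (b _)); lia|lia].
rewrite -/r -/(w m.+2) -/(w m.+1) -/(w m); set c := cos _; set Q := Num.sqrt _.
set X := \sum_(j < m.+2) _; lra.
Qed.
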